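(* Let $n=2k\geq6$ be even and let $(s,\pi,L,U)$ be an admissible quadruple. Write $i^*=i^*(\pi,L,U)$. Then $(s,\pi,L,U)$ encodes a feasible basis if and only if the following conditions are satisfied: (i) $|U|=|L|=k-1$; (ii) $\pi(s)\in U$; (iii) $s-1\in R\cup U$, where $R=\{1\}$; (iv) $|I(i^* )\setminus\{1,\pi^{-1}(1)\}|\geq(n-4)/2$; (v) $N_{UL}(i)+N_{UR}(i)+N_{RL}(i)\leq N_{LU}(i)+1$ for all $i\in([n]\setminus\{s,s-1\})\setminus I(i^* )$.
   Context: Let $K_n$ be the complete digraph on $V=[n]$ (all arcs $(i,j)$, $i\neq j$). For $\beta\in(0,1)$, $\mathcal{WH}_\beta(K_n)$ is the set of $(x,y)$, $x=(x_{ij})_{i\neq j}$, $y=(y_i)_{i\neq1}$, with (1) $\sum_{j\neq1}x_{1j}-\beta\sum_{j\neq1}x_{j1}=1-\beta^n$; (2) $\sum_{j\neq i}x_{ij}-\beta\sum_{j\neq i}x_{ji}=0$ for $i\in V\setminus\{1\}$; (3) $\sum_{j\neq1}x_{1j}=1$; (4) $\sum_{j\neq i}x_{ij}-y_i=\beta^{n-1}$ for $i\in V\setminus\{1\}$; (5) $0\leq y_i\leq\beta-\beta^{n-1}$ for $i\in V\setminus\{1\}$; (6) $x_{ij}\geq0$ for $i\neq j$. Indices $i\pm1,i\pm2$ are taken modulo $n$ in $[n]$. An admissible quadruple $(s,\pi,L,U)$ consists of a node $s\in\{2,\dots,n\}$, a fixed-point free permutation $\pi$ of $[n]$ such that $\pi(i)=i+1$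 if and only if $i=s-1$, and a partition $[n]=\{1,s\}\cup L\cup U$ (disjoint from $\{1,s\}$; $L,U$ possibly empty). It encodes the basis $(B,L,U)$ with basic variables $y_s$, $x_{i\,\pi(i)}$ for $i\in[n]$, and $x_{i\,\pi(i-1)}$ for $i\in[n]\setminus\{s\}$. The associated basic solution is the unique solution of (1)–(4) in which all non-basic $x$-variables are $0$, $y_i=0$ for $i\in L$ and $y_i=\beta-\beta^{n-1}$ for $i\in U$. The basis is called feasible if this solution satisfies (5) and (6) for all $\beta<1$ sufficiently close to $1$ (feasibility does not depend on $\beta$ for $\beta$ sufficiently close to $1$). Put $R=\{1\}$ and, for $P,Q\in\{L,U,R\}$, $W_{PQ}=\{i\in[n]\setminus\{s\}: i\in P,\ \pi(i)\in Q\}$. For $i\in[n]\setminus\{s,s-1\}$, $I(i)=\{s+1,\dots,i\}$ if $s+1\leq i\leq n$, and $I(i)=\{s+1,\dots,n,1,2,\dots,i\}$ if $1\leq i\leq s-2$; and $N_{PQ}(i)=|I(i)\cap W_{PQ}|$. If $s-1\in R\cup U$ and $\pi(s)\in U$, then there is a unique index $i^*=i^*(\pi,L,U)\in[n]\setminus\{s,s-1\}$ such that $N_{UL}(i^* )+N_{UR}(i^* )+N_{RL}(i^* )=N_{LU}(i^* )+1$ and $N_{UL}(i)+N_{UR}(i)+N_{RL}(i)\leq N_{LU}(i)$ for all $i\in I(i^* )\setminus\{i^*\}$. (Conditions (iv) and (v) are only considered when (ii) and (iii) hold.) *)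

(* Defs.v *)
From mathcomp Require Import all_boot all_order all_algebra all_fingroup reals.

Set Implicit Arguments.
Unset Strict Implicit.
Unset Printing Implicit Defensive.

Import Order.TTheory GRing.Theory Num.Theory.

(* The number of nodes is n = m.+1, and the node i of [n] = {1, ..., n} is the
   ordinal of value i - 1 in 'I_m.+1: node 1 is ord0, and ordS, ord_pred are
   the cyclic i |-> i + 1 and i |-> i - 1. *)

Section WeightedHamiltonian.
Local Open Scope ring_scope.

(* A point (x, y) is a pair p with x_ij = p.1 i j and y_i = p.2 0 i.  The
   coordinates x_ii and y_1 do not exist in the polytope: no constraint below
   mentions them, and basic_solution sets them to 0. *)
Definition point (F : realType) (m : nat) : Type :=
  ('M[F]_m.+1 * 'rV[F]_m.+1)%type.

Definition outflow (F : realType) (m : nat) (x : 'M[F]_m.+1) (i : 'I_m.+1) : F :=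
  \sum_(j | j != i) x i j.

Definition inflow (F : realType) (m : nat) (x : 'M[F]_m.+1) (i : 'I_m.+1) : F :=
  \sum_(j | j != i) x j i.

Definition WH_equations (F : realType) (m : nat) (beta : F) (p : point F m) : Prop :=
  [/\ outflow p.1 ord0 - beta * inflow p.1 ord0 = 1 - beta ^+ m.+1,
      forall i, i != ord0 -> outflow p.1 i - beta * inflow p.1 i = 0,
      outflow p.1 ord0 = 1
    & forall i, i != ord0 -> outflow p.1 i - p.2 0 i = beta ^+ m].

Definition WH_bounds (F : realType) (m : nat) (beta : F) (p : point F m) : Prop :=
  (forall i, i != ord0 -> 0 <= p.2 0 i <= beta - beta ^+ m) /\
  (forall i j, i != j -> 0 <= p.1 i j).

Definition admissible (m : nat) (s : 'I_m.+1) (pi : {perm 'I_m.+1})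
    (L U : {set 'I_m.+1}) : Prop :=
  [/\ s != ord0,
      forall i, pi i != i,
      forall i, pi i = ordS i <-> i = ord_pred s
    & [/\ [set ord0; s] :|: L :|: U = [set: 'I_m.+1],
          [disjoint L & U], [disjoint [set ord0; s] & L]
        & [disjoint [set ord0; s] & U]]].

Definition basic_arc (m : nat) (s : 'I_m.+1) (pi : {perm 'I_m.+1})
    (i j : 'I_m.+1) : bool :=
  (j == pi i) || ((i != s) && (j == pi (ord_pred i))).

Definition basic_solution (F : realType) (m : nat) (beta : F) (s : 'I_m.+1)
    (pi : {perm 'I_m.+1}) (L U : {set 'I_m.+1}) (p : point F m) : Prop :=
  [/\ WH_equations beta p,
      forall i j, ~~ basic_arc s pi i j -> p.1 i j = 0,
      forall i, i \in L -> p.2 0 i = 0,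
      forall i, i \in U -> p.2 0 i = beta - beta ^+ m
    & (forall i, p.1 i i = 0) /\ p.2 0 ord0 = 0].

Definition feasible_basis (F : realType) (m : nat) (s : 'I_m.+1)
    (pi : {perm 'I_m.+1}) (L U : {set 'I_m.+1}) : Prop :=
  exists beta0 : F, 0 <= beta0 < 1 /\
    forall beta : F, beta0 < beta < 1 ->
      exists p : point F m,
        unique (@basic_solution F m beta s pi L U) p /\ WH_bounds beta p.

End WeightedHamiltonian.

(* The class R = {1}. *)
Definition Rset (m : nat) : {set 'I_m.+1} := [set ord0].

Definition W (m : nat) (s : 'I_m.+1) (pi : {perm 'I_m.+1})
    (P Q : {set 'I_m.+1}) : {set 'I_m.+1} :=
  [set i | [&& i != s, i \in P & pi i \in Q]].

(* Only meaningful for i different from s and ord_pred s. *)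
Definition Iset (m : nat) (s i : 'I_m.+1) : {set 'I_m.+1} :=
  if s < i then [set j : 'I_m.+1 | s < j <= i]
  else [set j : 'I_m.+1 | (s < j) || (j <= i)].

Definition N (m : nat) (s : 'I_m.+1) (pi : {perm 'I_m.+1})
    (P Q : {set 'I_m.+1}) (i : 'I_m.+1) : nat :=
  #|Iset s i :&: W s pi P Q|.

(* N_UL(i) + N_UR(i) + N_RL(i) *)
Definition Nup (m : nat) (s : 'I_m.+1) (pi : {perm 'I_m.+1})
    (L U : {set 'I_m.+1}) (i : 'I_m.+1) : nat :=
  N s pi U L i + N s pi U (Rset m) i + N s pi (Rset m) L i.

(* At most one i satisfies this; there is one if s - 1 is in R :|: U and pi s is
   in U. *)
Definition is_istar (m : nat) (s : 'I_m.+1) (pi : {perm 'I_m.+1})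
    (L U : {set 'I_m.+1}) (i : 'I_m.+1) : Prop :=
  [/\ i \notin [set s; ord_pred s],
      Nup s pi L U i = (N s pi L U i).+1
    & forall j, j \in Iset s i :\ i -> Nup s pi L U j <= N s pi L U j].

(* Main.v *)
Require Import Defs.
From mathcomp Require Import all_boot all_order all_algebra all_fingroup reals.
From mathcomp Require Import zify ring lra.

Set Implicit Arguments.
Unset Strict Implicit.
Unset Printing Implicit Defensive.

Import Order.TTheory GRing.Theory Num.Theory.

(** Write beta = 1 - e.  The basic arcs are i -> pi i and i + 1 -> pi i (the
    latter except for i = s - 1), so that out-copies and in-copies of the nodes,
    joined by the basic arcs, form one path
      s, pi s, s + 1, pi (s + 1), ..., s - 1, pi (s - 1) = s.
    The equations prescribe the flow out of and into every node other than s: the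
    pair (out, in) is (1, beta^(n-1)) at node 1, (beta, 1) at a node
    of U and (beta^(n-1), beta^(n-2)) at a node of L.  Equality of the total
    outflow and inflow determines the flow through s, and walking along the
    path determines all arcs: the arc i + 1 -> pi i carries
      b_i = sum over j in {s, ..., i} of (in (pi j) - out j),
    and i -> pi i carries out_i - b_(i-1).  All of these are polynomials in e
    ([outP], [inP], [backP], [forwP]); the basic solution is unique for each
    beta in (0, 1), and feasibility becomes the nonnegativity of these
    polynomials, and of the slacks of y_s, for small e > 0
    ([feasible_basisE]).  The sign of a polynomial near 0 is that of its lowest
    nonzero coefficient ([near1_horner_gt0]), so the theorem is a computation of
    Taylor coefficients.

    All flows in and out are 1 at e = 0.  Hence the arcs i -> pi i carry 1 + O(e)
    and constrain nothing, and b_i = O(e).  The first order coefficients of the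
    slacks of y_s are nonnegative exactly if |L| = k - 1.  That of b_s forces
    pi s into U and is then n/2.  For i other than s and s - 1, each step j in
    I(i) adds 1 unless j or pi j is node 1, and subtracts n - 2 times
    [j not in L] - [pi j in U]; the sum of these differences over I(i) is
      D(i) = N_UL(i) + N_UR(i) + N_RL(i) - N_LU(i),
    so the first order coefficient of b_i is
      n/2 + |I(i) \ {1, pi^-1 1}| - (n - 2) D(i).
    As I(i) has at most n - 2 elements, this is negative if D(i) >= 2, positive
    if D(i) <= 0, and for D(i) = 1 it is nonnegative exactly if
    |I(i) \ {1, pi^-1 1}| >= (n - 4)/2.  In the borderline case of equality the
    second order coefficient decides; it is at least
    (k - 1)(2k - 3)(k - 2)/3 > 0 ([coef2_backP_gt0]).  Since I(i) grows with i,
    the cardinality condition need only be checked at the first i with D(i) = 1,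
    which is i*.  Finally D(s - 2) = 2 - [s - 1 not in L]
    ([level_lastinner]), which gives both s - 1 in R or U and the existence of
    i*. *)

(** * Signs of polynomials near beta = 1 *)

Section NearOne.
Local Open Scope ring_scope.
Variable F : realType.

Definition near1 (P : F -> Prop) : Prop :=
  exists beta0 : F, 0 <= beta0 < 1 /\
    forall beta, beta0 < beta < 1 -> P beta.

Lemma near1T (P : F -> Prop) :
  (forall beta, 0 < beta < 1 -> P beta) -> near1 P.
Proof. by move=> P01; exists 0; split=> //; rewrite lexx ltr01. Qed.

Lemma near1_imp (P Q : F -> Prop) :
  (forall beta, 0 < beta < 1 -> P beta -> Q beta) -> near1 P -> near1 Q.
Proof.
move=> PQ [b0 [b0P Pb]]; exists b0; split=> // b b0b.
by apply: PQ (Pb b b0b); lra.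
Qed.

Lemma near1_and (P Q : F -> Prop) :
  near1 P -> near1 Q -> near1 (fun beta => P beta /\ Q beta).
Proof.
move=> [b0 [/andP[b00 b01] Pb]] [b1 [/andP[b10 b11] Qb]].
exists (Num.max b0 b1); split; first by rewrite le_max gt_max b00 b01 b11.
move=> b; rewrite gt_max => /andP[/andP[b0b b1b] b_lt1].
by split; [apply: Pb; rewrite b0b | apply: Qb; rewrite b1b].
Qed.

Lemma near1_forall (T : finType) (P : T -> F -> Prop) :
  (forall t, near1 (P t)) -> near1 (fun beta => forall t, P t beta).
Proof.
move=> nP; suff H (s : seq T) : near1 (fun b => forall t, t \in s -> P t b).
  by apply: near1_imp (H (enum T)) => b _ Pb t; apply: Pb; rewrite mem_enum.
elim: s => [|t s IHs]; first exact: near1T.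
apply: near1_imp (near1_and (nP t) IHs) => b _ [Pt Ps] u.
by rewrite inE => /predU1P[->|/Ps].
Qed.

Lemma near1_False : ~ near1 (fun=> False).
Proof. by move=> [b0 [b0P /(_ ((b0 + 1) / 2))]]; apply; lra. Qed.

(** Factor out 'X^k: the cofactor is q`_k + t * 'X, and on [0, 1] the values of t
    are bounded by the sum K of the absolute values of its coefficients. *)
Lemma near1_horner_gt0 (q : {poly F}) (k : nat) :
  (forall i, (i < k)%N -> q`_i = 0) -> 0 < q`_k ->
  near1 (fun beta => 0 < q.[1 - beta]).
Proof.
move=> q0 qk.
have -> : q = drop_poly k q * 'X^k.
  rewrite -[LHS](poly_take_drop k); suff -> : take_poly k q = 0 by rewrite add0r.
  by apply/polyP => i; rewrite coef_take_poly coef0; case: ltnP => // /q0.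
set r := drop_poly k q; have r0 : r`_0 = q`_k by rewrite coef_drop_poly.
pose t := drop_poly 1 r; pose K := \sum_(i < size t) `|t`_i|.
have rE x : r.[x] = q`_k + t.[x] * x.
  rewrite -{1}(poly_take_drop 1 r) !hornerE -r0; congr (_ + _).
  by rewrite /take_poly poly_def big_ord1 !hornerE.
have K0 : 0 <= K by apply: sumr_ge0.
have tK x : 0 <= x <= 1 -> `|t.[x]| <= K.
  move=> /andP[x0 x1]; rewrite horner_coef; apply: le_trans (ler_norm_sum _ _ _) _.
  apply: ler_sum => i _; rewrite normrM ler_piMr // normrX ger0_norm //.
  exact: exprn_ile1.
have L0 : 0 < q`_k + K by lra.
exists (1 - q`_k / (q`_k + K)); split.
  rewrite subr_ge0 ltrBlDr ltrDl divr_gt0 // andbT ler_pdivrMr //; lra.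
move=> b /andP[bl b1]; rewrite !hornerE; apply: mulr_gt0; last first.
  by rewrite exprn_gt0 //; lra.
have : 1 - b < q`_k / (q`_k + K) by lra.
rewrite ltr_pdivlMr // => H.
have le1 : q`_k / (q`_k + K) <= 1 by rewrite ler_pdivrMr //; lra.
have xP : 0 <= 1 - b <= 1 by lra.
rewrite rE.
have: - (t.[1 - b] * (1 - b)) <= K * (1 - b).
  rewrite -mulNr; apply: ler_wpM2r; first lra.
  by apply: le_trans (ler_norm _) _; rewrite normrN; apply: tK.
have : 0 < q`_k * (1 - b) by apply: mulr_gt0 => //; lra.
nra.
Qed.

Lemma near1_horner_not_ge0 (q : {poly F}) (k : nat) :
  (forall i, (i < k)%N -> q`_i = 0) -> q`_k < 0 ->
  ~ near1 (fun beta => 0 <= q.[1 - beta]).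
Proof.
move=> q0 qk q_ge0; apply: near1_False.
have Nq : near1 (fun beta => 0 < (- q).[1 - beta]).
  apply: (@near1_horner_gt0 _ k); last by rewrite coefN oppr_gt0.
  by move=> i /q0 qi; rewrite coefN qi oppr0.
apply: near1_imp (near1_and q_ge0 Nq) => b _ [qb]; rewrite hornerN oppr_gt0.
by rewrite ltNge qb.
Qed.

(** beta itself, as a polynomial in the variable 1 - beta. *)
Definition betaX : {poly F} := 1 - 'X.

Lemma horner_betaX (beta : F) : betaX.[1 - beta] = beta.
Proof. by rewrite !hornerE; ring. Qed.

Lemma coef_betaX_exp (j i : nat) :
  (betaX ^+ j)`_i = (-1) ^+ i * 'C(j, i)%:R.
Proof.
elim: j i => [|j IHj] i.
  by rewrite expr0 coef1; case: i => [|i]; rewrite ?mulr1 ?mulr0.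
rewrite exprS mulrBl mul1r coefB coefXM !IHj; case: i => [|i].
  by rewrite /= subr0 !bin0.
by rewrite /= binS natrD exprS; ring.
Qed.

Lemma near1_coef1_ge0 (q : {poly F}) : q`_0 = 0 ->
  near1 (fun beta => 0 <= q.[1 - beta]) -> 0 <= q`_1.
Proof.
move=> q0 H; rewrite leNgt; apply/negP => q1.
by apply: near1_horner_not_ge0 q1 H => -[].
Qed.

Lemma near1_horner_ge0 (q : {poly F}) (k : nat) :
  (forall i, (i < k)%N -> q`_i = 0) -> 0 < q`_k ->
  near1 (fun beta => 0 <= q.[1 - beta]).
Proof.
by move=> q0 qk; apply: near1_imp (near1_horner_gt0 q0 qk) => b _ /ltW.
Qed.

End NearOne.

(** * Counting *)

Section Counting.
Local Open Scope ring_scope.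

Lemma sum_mem_card (V : pzRingType) (T : finType) (A C : {set T}) :
  \sum_(j in A) (j \in C)%:R = #|A :&: C|%:R :> V.
Proof.
rewrite -sum1_card natr_sum [RHS](eq_bigl (fun j => (j \in A) && (j \in C))).
  by rewrite big_mkcondr; apply: eq_bigr => j _; case: (j \in C).
by move=> j; rewrite in_setI.
Qed.

Lemma natr_bin2 (V : numFieldType) q : 'C(q, 2)%:R = q%:R * (q%:R - 1) / 2 :> V.
Proof.
elim: q => [|q IHq]; first by rewrite bin_small // mul0r mul0r.
by rewrite binS natrD IHq bin1 -natr1; field.
Qed.

Lemma natr_bin3 (V : numFieldType) q :
  'C(q, 3)%:R = q%:R * (q%:R - 1) * (q%:R - 2) / 6 :> V.
Proof.
elim: q => [|q IHq]; first by rewrite bin_small // !mul0r.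
by rewrite binS natrD IHq natr_bin2 -natr1; field.
Qed.

Lemma sum_bin (q r : nat) : (\sum_(j < q) 'C(j.+1, r.+1) = 'C(q.+1, r.+2))%N.
Proof.
elim: q => [|q IHq]; first by rewrite big_ord0 bin_small.
by rewrite big_ord_recr /= IHq -binS.
Qed.

End Counting.

(** * Positions along the path *)

Section Cyclic.
Variables (m : nat) (s : 'I_m.+1).

Definition pos (i : 'I_m.+1) : nat := if s <= i then i - s else i + m.+1 - s.

Lemma pos_le i : pos i <= m.
Proof. by rewrite /pos; have := ltn_ord i; have := ltn_ord s; case: (leqP s i); lia. Qed.

Lemma pos_inj : injective pos.
Proof.
move=> i j; rewrite /pos => e; apply: val_inj => /=; move: e.
have := ltn_ord i; have := ltn_ord j; have := ltn_ord s.
by case: (leqP s i); case: (leqP s j); lia.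
Qed.

Lemma pos_base : pos s = 0.
Proof. by rewrite /pos leqnn subnn. Qed.

Lemma pos_eq0 i : (pos i == 0) = (i == s).
Proof. by rewrite -pos_base (inj_eq pos_inj). Qed.

Lemma val_ord_pred (i : 'I_m.+1) : ord_pred i = (if i == ord0 then m else i.-1) :> nat.
Proof.
rewrite /= -val_eqE /=; have := ltn_ord i.
case: (nat_of_ord i) => [|p] pm /=; first by rewrite modn_small.
by rewrite modnDr modn_small //; lia.
Qed.

Lemma pos_ord_pred i : i != s -> pos i = (pos (ord_pred i)).+1.
Proof.
rewrite -val_eqE /= => nis; rewrite /pos val_ord_pred -val_eqE /=.
have := ltn_ord i; have := ltn_ord s; case: (leqP s i).
  by case: eqP => [i0|]; [case: (leqP s m)|case: (leqP s i.-1)]; lia.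
by case: eqP => [i0|]; [case: (leqP s m)|case: (leqP s i.-1)]; lia.
Qed.

Lemma pos_ord_pred_base : pos (ord_pred s) = m.
Proof.
rewrite /pos val_ord_pred -val_eqE /=; have := ltn_ord s.
by case: eqP => [->|]; [case: (leqP 0 m)|case: (leqP s s.-1)]; lia.
Qed.

Lemma in_Iset i j : i != s -> (j \in Iset s i) = (0 < pos j <= pos i).
Proof.
rewrite /Iset /pos -val_eqE /= => nis.
have := ltn_ord i; have := ltn_ord s; have := ltn_ord j.
by case: (ltnP s i) => si; rewrite inE; case: (leqP s j); case: (leqP s i); lia.
Qed.
End Cyclic.

(** * Nodes of an admissible quadruple *)

Section Basis.
Local Open Scope ring_scope.
Variables (F : realType) (m : nat) (s : 'I_m.+1) (pi : {perm 'I_m.+1}).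
Variables (L U : {set 'I_m.+1}).
Hypothesis hadm : admissible s pi L U.

Lemma base_neq0 : s != ord0.
Proof. by case: hadm. Qed.

Lemma m_gt0 : (0 < m)%N.
Proof.
by case: m s base_neq0 => // t; rewrite -val_eqE /=; have := ltn_ord t; lia.
Qed.

Lemma pi_neq i : pi i != i.
Proof. by case: hadm. Qed.

Lemma pi_pred_base : pi (ord_pred s) = s.
Proof. by case: hadm => _ _ /(_ (ord_pred s)) [_ ->] // _; rewrite ord_predK. Qed.

Lemma pi_pred_neq i : i != s -> pi (ord_pred i) != i.
Proof.
apply: contraNneq => pii; case: hadm => _ _ /(_ (ord_pred i)) [/(_ _) H _] _.
by apply/eqP/ord_pred_inj/H; rewrite ord_predK.
Qed.

Lemma ord_pred_neq (i : 'I_m.+1) : ord_pred i != i.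
Proof.
apply/eqP => /(congr1 (@nat_of_ord _)); rewrite val_ord_pred -val_eqE /=.
by have := m_gt0; case: eqP; lia.
Qed.

Lemma notin_L0 : ord0 \notin L.
Proof.
case: hadm => _ _ _ [_ _ /disjoint_setI0/setP/(_ ord0) + _].
by rewrite !inE eqxx /= => ->.
Qed.

Lemma notin_Ls : s \notin L.
Proof.
case: hadm => _ _ _ [_ _ /disjoint_setI0/setP/(_ s) + _].
by rewrite !inE eqxx orbT /= => ->.
Qed.

Lemma notin_U0 : ord0 \notin U.
Proof.
case: hadm => _ _ _ [_ _ _ /disjoint_setI0/setP/(_ ord0)].
by rewrite !inE eqxx /= => ->.
Qed.

Lemma notin_Us : s \notin U.
Proof.
case: hadm => _ _ _ [_ _ _ /disjoint_setI0/setP/(_ s)].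
by rewrite !inE eqxx orbT /= => ->.
Qed.

Lemma in_L i : (i \in L) = [&& i != ord0, i != s & i \notin U].
Proof.
apply/idP/and3P => [iL|[i0 is_ iU]].
  split; [by apply: contraNneq notin_L0 => <- | by apply: contraNneq notin_Ls => <- |].
  case: hadm => _ _ _ [_ /disjoint_setI0/setP/(_ i) + _ _].
  by rewrite !inE iL /= => ->.
case: hadm => _ _ _ [/setP/(_ i) + _ _ _].
by rewrite !inE (negPf i0) (negPf is_) (negPf iU) orbF.
Qed.

Lemma in_U i : (i \in U) = [&& i != ord0, i != s & i \notin L].
Proof.
apply/idP/and3P => [iU|[i0 is_]]; last by rewrite in_L i0 is_ /= negbK.
split; last by rewrite in_L iU !andbF.
  by apply: contraTneq iU => ->; exact: notin_U0.
by apply: contraTneq iU => ->; exact: notin_Us.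
Qed.

Lemma sum_class (V : zmodType) (g : 'I_m.+1 -> V) :
  \sum_i g i = g ord0 + g s + \sum_(i in L) g i + \sum_(i in U) g i.
Proof.
rewrite (bigD1 ord0) //= (bigD1 s) ?base_neq0 //= -!addrA; congr (_ + (_ + _)).
rewrite (bigID (fun i => i \in L)) /=; congr (_ + _); apply: eq_bigl => i.
  by rewrite in_L; case: (i == _); case: (i == _).
by rewrite in_U -andbA.
Qed.

Lemma card_class : (#|L| + #|U| = m.-1)%N.
Proof.
have := sum_class (fun=> 1%Z); rewrite !sumr_const card_ord.
by rewrite !pmulrn; lia.
Qed.

(** * The basic solution as a family of polynomials *)

Local Notation B := (betaX F).

(** The inflow of s that makes the total excess vanish.  The common factor
    1 - beta of the balance equation is cancelled, so that this is a
    polynomial: 1 - beta^m over 1 - beta is a geometric sum. *)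
Definition inflow_base : {poly F} :=
  \sum_(j < m) B ^+ j - B ^+ m.-1 *+ #|L| - 1 *+ #|U|.

Definition outP (i : 'I_m.+1) : {poly F} :=
  if i == ord0 then 1 else if i == s then B * inflow_base
  else if i \in U then B else B ^+ m.

Definition inP (i : 'I_m.+1) : {poly F} :=
  if i == ord0 then B ^+ m else if i == s then inflow_base
  else if i \in U then 1 else B ^+ m.-1.

Definition excess (i : 'I_m.+1) : {poly F} := inP (pi i) - outP i.

(** The flow on i + 1 -> pi i: the path is cut at s, which receives flow only
    from s - 1. *)
Definition backP (i : 'I_m.+1) : {poly F} :=
  \sum_(j | (pos s j <= pos s i)%N) excess j.

(** The flow on i -> pi i. *)
Definition forwP (i : 'I_m.+1) : {poly F} := outP i - backP (ord_pred i).

Lemma outP_inP i : i != ord0 -> outP i = B * inP i.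
Proof.
move=> /negPf i0; rewrite /outP /inP i0; case: eqP => // _.
by case: ifP; rewrite ?mulr1 // -exprS prednK // m_gt0.
Qed.

Lemma sum_excess : \sum_i excess i = 0.
Proof.
rewrite sumrB -(reindex_inj (P := predT) (F := inP) (@perm_inj _ pi)) /=.
rewrite -sumrB sum_class.
rewrite {1 2}/inP {1 2}/outP eqxx (negPf base_neq0) eqxx.
rewrite (eq_bigr (fun=> B ^+ m.-1 - B ^+ m)); last first.
  move=> i; rewrite in_L => /and3P[/negPf i0 /negPf is_ /negPf iU].
  by rewrite /inP /outP i0 is_ iU.
rewrite [X in _ + X](eq_bigr (fun=> 1 - B)); last first.
  move=> i iU; have := iU; rewrite in_U => /and3P[/negPf i0 /negPf is_ _].
  by rewrite /inP /outP i0 is_ iU.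
rewrite !sumr_const /inflow_base.
have e1 : (B - 1) * \sum_(j < m) B ^+ j = B ^+ m - 1 by rewrite -subrX1.
have e2 : B ^+ m = B * B ^+ m.-1 by rewrite -exprS prednK // m_gt0.
rewrite -[_ ^+ m.-1 *+ _]mulr_natr -[(_ - _) *+ #|L|]mulr_natr.
rewrite -[(_ - _) *+ #|U|]mulr_natr.
set S := \sum_(j < m) _ in e1 *; rewrite e2 in e1 *.
transitivity (B * B ^+ m.-1 - 1 - (B - 1) * S); first ring.
by rewrite e1 subrr.
Qed.

Lemma backP_base : backP s = excess s.
Proof.
rewrite /backP pos_base (eq_bigl (pred1 s)) ?big_pred1_eq // => j.
by rewrite leqn0 pos_eq0.
Qed.

Lemma backP_pred_base : backP (ord_pred s) = 0.
Proof.
rewrite /backP pos_ord_pred_base -[RHS]sum_excess.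
by apply: eq_bigl => j; rewrite pos_le.
Qed.

(** At i = s the recursion closes up around the cycle because the total excess
    is 0. *)
Lemma backP_rec i : backP i = backP (ord_pred i) + excess i.
Proof.
have [->|nis] := eqVneq i s; first by rewrite backP_pred_base add0r backP_base.
rewrite {1}/backP (bigD1 i) //= addrC; congr (_ + _); apply: eq_bigl => j.
have := pos_ord_pred nis; rewrite -(inj_eq (@pos_inj _ s)); lia.
Qed.

Lemma backP_Iset i : i != s ->
  backP i = excess s + \sum_(j in Iset s i) excess j.
Proof.
move=> nis; rewrite /backP (bigD1 s) ?pos_base //=; congr (_ + _).
by apply: eq_bigl => j; rewrite in_Iset // -(pos_eq0 s j); lia.
Qed.

(** * Uniqueness of the basic solution *)

Definition supported (x : 'M[F]_m.+1) :=
  (forall i j, ~~ basic_arc s pi i j -> x i j = 0) /\ (forall i, x i i = 0).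

(** For i = s the second term is the diagonal entry x s s = 0, and the second
    term of [inflow_basic] vanishes likewise for i = s - 1. *)
Lemma outflow_basic x i : supported x ->
  outflow x i = x i (pi i) + x i (pi (ord_pred i)).
Proof.
move=> [x0 xd].
have npi : pi (ord_pred i) != pi i by rewrite (inj_eq perm_inj) ord_pred_neq.
transitivity (\sum_j x i j).
  by rewrite [RHS](bigD1 i) //= xd add0r.
rewrite (bigD1 (pi i)) //= (bigD1 (pi (ord_pred i))) //= big1 ?addr0 // => j.
by move=> /andP[/negPf ji /negPf jp]; rewrite x0 // /basic_arc ji jp andbF.
Qed.

Lemma inflow_basic x i : supported x ->
  inflow x (pi i) = x i (pi i) + x (ordS i) (pi i).
Proof.
move=> [x0 xd].
have nS : ordS i != i by rewrite -{2}(ordSK i) eq_sym ord_pred_neq.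
transitivity (\sum_j x j (pi i)).
  by rewrite [RHS](bigD1 (pi i)) //= xd add0r.
rewrite (bigD1 i) //= (bigD1 (ordS i)) //= big1 ?addr0 // => j /andP[ji jS].
rewrite x0 // /basic_arc !(inj_eq perm_inj) eq_sym (negPf ji) /= negb_and.
by apply/orP; right; apply: contraNneq jS => ->; rewrite ord_predK.
Qed.

Lemma sum_inflow_outflow (x : 'M[F]_m.+1) :
  \sum_i inflow x i = \sum_i outflow x i.
Proof.
rewrite /inflow /outflow (exchange_big_dep predT) //=; apply: eq_bigr => i _.
by apply: eq_bigl => j; rewrite eq_sym.
Qed.

Definition sol (beta : F) : point F m :=
  (\matrix_(i, j) if j == pi i then (forwP i).[1 - beta]
     else if (i != s) && (j == pi (ord_pred i))
          then (backP (ord_pred i)).[1 - beta] else 0,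
   \row_i if i == ord0 then 0 else (outP i - B ^+ m).[1 - beta]).

Section Beta.
Variable (beta : F).
Hypothesis (b01 : 0 < beta < 1).

Lemma sol_forw i : (sol beta).1 i (pi i) = (forwP i).[1 - beta].
Proof. by rewrite mxE eqxx. Qed.

Lemma sol_back i :
  (sol beta).1 i (pi (ord_pred i)) = (backP (ord_pred i)).[1 - beta].
Proof.
rewrite mxE (inj_eq perm_inj) (negPf (ord_pred_neq i)) eqxx andbT.
by case: eqVneq => // ->; rewrite backP_pred_base horner0.
Qed.

Lemma sol_supported : supported (sol beta).1.
Proof.
split=> [i j|i]; rewrite mxE.
  by rewrite /basic_arc negb_or => /andP[/negPf -> /negPf ->].
rewrite eq_sym (negPf (pi_neq i)); case: eqVneq => //= nis.
by rewrite eq_sym (negPf (pi_pred_neq nis)).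
Qed.

Lemma outflow_sol i : outflow (sol beta).1 i = (outP i).[1 - beta].
Proof.
rewrite (outflow_basic _ sol_supported) sol_forw sol_back -hornerD.
by rewrite /forwP subrK.
Qed.

Lemma inflow_sol i : inflow (sol beta).1 i = (inP i).[1 - beta].
Proof.
suff pi_case j : inflow (sol beta).1 (pi j) = (inP (pi j)).[1 - beta].
  by rewrite -[i](permKV pi).
rewrite (inflow_basic _ sol_supported) sol_forw.
have := sol_back (ordS j); rewrite ordSK => ->; rewrite -hornerD.
by rewrite /forwP (backP_rec j) /excess; congr horner; ring.
Qed.

Lemma sol_basic : basic_solution beta s pi L U (sol beta).
Proof.
have [sup dg] := sol_supported.
split; [|by []| | |]; last by split=> //; rewrite mxE eqxx.
- split; rewrite ?outflow_sol ?inflow_sol.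
  + by rewrite /outP /inP eqxx hornerE horner_exp horner_betaX exprS.
  + move=> i i0; rewrite outflow_sol inflow_sol outP_inP // hornerM horner_betaX.
    by rewrite subrr.
  + by rewrite /outP eqxx hornerE.
  + move=> i i0; rewrite outflow_sol mxE (negPf i0) hornerD hornerN horner_exp.
    by rewrite horner_betaX; ring.
- move=> i; rewrite in_L => /and3P[/negPf i0 /negPf is_ /negPf iU].
  by rewrite mxE /outP i0 is_ iU subrr horner0.
- move=> i iU; have := iU; rewrite in_U => /and3P[/negPf i0 /negPf is_ _].
  by rewrite mxE /outP i0 is_ iU hornerD hornerN horner_exp horner_betaX.
Qed.

(** Away from s the constraints give both flows.  At s they only give
    outflow = beta * inflow, and comparing the total inflow and outflow with those
    of the explicit solution leaves (1 - beta) times the difference of the two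
    inflows of s equal to 0. *)
Lemma basic_flows p : basic_solution beta s pi L U p ->
  forall i, outflow p.1 i = (outP i).[1 - beta] /\
            inflow p.1 i = (inP i).[1 - beta].
Proof.
move=> [[h1 h2 h3 h4] x0 yL yU [xd y0]].
have b0 : beta != 0 by apply: lt0r_neq0; case/andP: b01.
have H i : i != s -> outflow p.1 i = (outP i).[1 - beta] /\
            inflow p.1 i = (inP i).[1 - beta].
  move=> nis; have [->|i0] := eqVneq i ord0.
    rewrite /outP /inP eqxx h3 hornerE horner_exp horner_betaX; split=> //.
    apply: (mulfI b0); rewrite -exprS; move: h1; rewrite h3; lra.
  suff o : outflow p.1 i = (outP i).[1 - beta].
    split=> //; apply: (mulfI b0); have := h2 i i0.
    by rewrite o outP_inP // hornerM horner_betaX; lra.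
  have [iU|iU] := boolP (i \in U); have := h4 i i0.
    by rewrite yU // /outP (negPf i0) (negPf nis) iU horner_betaX; lra.
  rewrite yL ?in_L ?i0 ?nis // /outP (negPf i0) (negPf nis) (negPf iU).
  by rewrite horner_exp horner_betaX; lra.
suff Hs : inflow p.1 s = (inP s).[1 - beta].
  move=> i; have [->|/H //] := eqVneq i s; split=> //.
  have := h2 s base_neq0; rewrite Hs outP_inP ?base_neq0 // hornerM horner_betaX.
  by lra.
have e1 : \sum_i (inflow p.1 i - outflow p.1 i) = 0.
  by rewrite sumrB sum_inflow_outflow subrr.
have e2 : \sum_i ((inP i).[1 - beta] - (outP i).[1 - beta]) = 0.
  under eq_bigr do rewrite -inflow_sol -outflow_sol.
  by rewrite sumrB sum_inflow_outflow subrr.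
rewrite (bigD1 s) //= in e1; rewrite (bigD1 s) //= in e2.
rewrite (eq_bigr (fun i => (inP i).[1 - beta] - (outP i).[1 - beta])) in e1;
  last by move=> i /H[-> ->].
have e3 := h2 s base_neq0.
have e4 : (outP s).[1 - beta] = beta * (inP s).[1 - beta].
  by rewrite outP_inP ?base_neq0 // hornerM horner_betaX.
have : (1 - beta) * (inflow p.1 s - (inP s).[1 - beta]) = 0.
  by move: e1 e2 e3 e4; set S := \sum_(_ | _) _; lra.
move=> /eqP; rewrite mulf_eq0 !subr_eq0 => /orP[/eqP b1|/eqP//].
by case/andP: b01 => _; rewrite -b1 ltxx.
Qed.

Lemma sol_unique p : basic_solution beta s pi L U p -> sol beta = p.
Proof.
move=> bp; have [[h1 h2 h3 h4] x0 yL yU [xd y0]] := bp.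
have sup : supported p.1 by [].
(* walk along the path from s, where the arc entered from s - 1 would be the loop x s s = 0 *)
have back i : p.1 (ordS i) (pi i) = (backP i).[1 - beta].
  have [k] := ubnP (pos s i); elim: k i => // k IHk i ik.
  suff prev : p.1 i (pi (ord_pred i)) = (backP (ord_pred i)).[1 - beta].
    have [+ _] := basic_flows bp i; have [_] := basic_flows bp (pi i).
    rewrite inflow_basic // outflow_basic // prev (backP_rec i) /excess !(hornerD, hornerN).
    by lra.
  have [->|nis] := eqVneq i s.
    by rewrite {1}pi_pred_base xd backP_pred_base horner0.
  by rewrite -{1}(ord_predK i) IHk //; have := pos_ord_pred nis; lia.
have forw i : p.1 i (pi i) = (forwP i).[1 - beta].
  have [+ _] := basic_flows bp i; rewrite outflow_basic //.
  by have := back (ord_pred i); rewrite ord_predK /forwP hornerD hornerN => ->; lra.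
have e1 : (sol beta).1 = p.1.
  apply/matrixP => i j; rewrite mxE; case: eqVneq => [->|ji]; first by rewrite forw.
  case: ifP => [/andP[nis /eqP ->]|H].
    by rewrite -back ord_predK.
  by rewrite x0 // /basic_arc (negPf ji) H.
have e2 : (sol beta).2 = p.2.
  apply/rowP => i; rewrite mxE; case: eqVneq => [->//|i0].
  have [o _] := basic_flows bp i; have := h4 i i0; rewrite o.
  by rewrite hornerD hornerN horner_exp horner_betaX; lra.
by rewrite [LHS]surjective_pairing e1 e2 -surjective_pairing.
Qed.

(** Only the node s has a bound on y that is not automatic. *)
Lemma sol_bounds : WH_bounds beta (sol beta) <->
  [/\ 0 <= (outP s - B ^+ m).[1 - beta], 0 <= (B - outP s).[1 - beta],
      forall i, 0 <= (forwP i).[1 - beta] & forall i, 0 <= (backP i).[1 - beta]].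
Proof.
split=> [[yb xb]|[s1 s2 fw bk]].
  have := yb s base_neq0; rewrite mxE (negPf base_neq0) => /andP[h1 h2].
  split=> // [|i|i].
  - by move: h2; rewrite !(horner_betaX, horner_exp, hornerD, hornerN); lra.
  - by rewrite -sol_forw xb // eq_sym pi_neq.
  - have [->|nis] := eqVneq i (ord_pred s).
      by rewrite backP_pred_base horner0.
    rewrite -[i]ordSK -sol_back xb // eq_sym pi_pred_neq //.
    by apply: contraNneq nis => <-; rewrite ordSK.
split=> [i i0|i j ij]; last first.
  by rewrite mxE; case: ifP => // _; case: ifP.
have bm : beta ^+ m <= beta.
  have [/ltW b0 /ltW b1] := andP b01.
  by rewrite -(prednK m_gt0) exprS ler_piMr // exprn_ile1.
have bm0 : 0 <= beta ^+ m by apply: exprn_ge0; case/andP: b01 => /ltW.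
rewrite mxE (negPf i0); have [->|nis] := eqVneq i s.
  rewrite s1 /=; move: s2; rewrite !(horner_betaX, horner_exp, hornerD, hornerN).
  by lra.
rewrite /outP (negPf i0) (negPf nis); case: ifP => _.
  by rewrite hornerD hornerN horner_exp horner_betaX; lra.
by rewrite subrr horner0; lra.
Qed.

End Beta.

Lemma feasible_basisE : feasible_basis F s pi L U <->
  near1 (fun beta : F =>
  [/\ 0 <= (outP s - B ^+ m).[1 - beta], 0 <= (B - outP s).[1 - beta],
      forall i, 0 <= (forwP i).[1 - beta] & forall i, 0 <= (backP i).[1 - beta]]).
Proof.
split=> H.
  have {}H : near1 (fun beta : F => exists p : point F m,
      unique (@basic_solution F m beta s pi L U) p /\ WH_bounds beta p) by [].
  apply: near1_imp H => b b01 [p [[bp _] pb]].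
  by apply/(sol_bounds b01); rewrite (sol_unique b01 bp).
suff: near1 (fun beta : F => exists p : point F m,
      unique (@basic_solution F m beta s pi L U) p /\ WH_bounds beta p) by [].
apply: near1_imp H => b b01 /(sol_bounds b01) bd.
by exists (sol b); split=> //; split; [apply: sol_basic | apply: sol_unique].
Qed.

(** * Taylor coefficients of the flows *)

(** Away from s, exactly one of R, L and U holds; destructing this makes all three
    membership tests compute. *)
Variant node_spec : bool -> bool -> bool -> Prop :=
  | NodeR : node_spec true false false
  | NodeL : node_spec false true false
  | NodeU : node_spec false false true.

Lemma nodeP i : i != s -> node_spec (i == ord0) (i \in L) (i \in U).
Proof.
rewrite in_L => ->; have [->|_] := eqVneq i ord0.
  by rewrite (negPf notin_U0); constructor.
by case: (i \in U); constructor.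
Qed.

Lemma pi_neq_both0 i : ~~ ((i == ord0) && (pi i == ord0)).
Proof.
have := pi_neq i; apply: contra => /andP[/eqP i0 /eqP p0].
by rewrite p0 i0.
Qed.

Lemma natr_m1 : m.-1%:R = m%:R - 1 :> F.
Proof. by rewrite -[in RHS](prednK m_gt0) -natr1 addrK. Qed.

Lemma outP_baseE :
  outP s = \sum_(j < m) B ^+ j.+1 - B ^+ m *+ #|L| - B *+ #|U|.
Proof.
rewrite /outP (negPf base_neq0) eqxx /inflow_base !mulrBr mulr_sumr.
rewrite !mulrnAr mulr1 -[B * B ^+ m.-1]exprS prednK ?m_gt0 //.
by congr (_ - _ - _); apply: eq_bigr => j _; rewrite exprS.
Qed.

Lemma coef_outP_base i : (outP s)`_i =
  (-1) ^+ i * ((\sum_(j < m) 'C(j.+1, i))%:R - 'C(m, i)%:R * #|L|%:R - 'C(1, i)%:R * #|U|%:R).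
Proof.
rewrite outP_baseE !coefB coef_sum !coefMn -{3}[B]expr1 !coef_betaX_exp.
rewrite -[_ *+ #|L|]mulr_natr -[_ *+ #|U|]mulr_natr.
rewrite !mulrBr natr_sum mulr_sumr !mulrA.
by congr (_ - _ - _); apply: eq_bigr => j _; rewrite coef_betaX_exp.
Qed.

Lemma natr_cardU : #|U|%:R = m%:R - 1 - #|L|%:R :> F.
Proof. by rewrite -natr_m1 -card_class natrD addrC addKr. Qed.

Lemma outP_base0 : (outP s)`_0 = 1.
Proof.
rewrite coef_outP_base expr0 mul1r !bin0 !mul1r natr_cardU.
by under eq_bigr do rewrite bin0; rewrite sum1_card card_ord; ring.
Qed.

Lemma outP_base1 :
  (outP s)`_1 = (m%:R - 1) * (#|L|%:R + 1) - m%:R * (m%:R + 1) / 2.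
Proof.
by rewrite coef_outP_base sum_bin !bin1 natr_bin2 natr_cardU -natr1; field.
Qed.

Lemma outP_base2 :
  (outP s)`_2 = (m%:R - 1) * (m%:R * (m%:R + 1) / 6 - #|L|%:R * m%:R / 2).
Proof.
by rewrite coef_outP_base sum_bin natr_bin3 natr_bin2 -natr1 bin_small //; field.
Qed.

Lemma coef_outP i c : i != s -> (outP i)`_c =
  (i == ord0)%:R * (c == 0)%:R + (-1) ^+ c *
  ('C(m, c)%:R * (i \in L)%:R + 'C(1, c)%:R * (i \in U)%:R).
Proof.
move=> nis; rewrite /outP (negPf nis); case: (nodeP nis) => /=.
- by rewrite coef1; ring.
- by rewrite coef_betaX_exp; ring.
- by have := coef_betaX_exp F 1 c; rewrite expr1 => ->; ring.
Qed.

Lemma coef_inP i c : i != s -> (inP i)`_c =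
  (i \in U)%:R * (c == 0)%:R + (-1) ^+ c *
  ('C(m, c)%:R * (i == ord0)%:R + 'C(m.-1, c)%:R * (i \in L)%:R).
Proof.
move=> nis; rewrite /inP (negPf nis); case: (nodeP nis) => /=.
- by rewrite coef_betaX_exp; ring.
- by rewrite coef_betaX_exp; ring.
- by rewrite coef1; ring.
Qed.

Lemma coef0_outP i : (outP i)`_0 = 1.
Proof.
have [->|nis] := eqVneq i s; first exact: outP_base0.
by rewrite coef_outP // !bin0; case: (nodeP nis) => /=; ring.
Qed.

Lemma coef0_inP i : (inP i)`_0 = 1.
Proof.
have [->|nis] := eqVneq i s.
  have := outP_base0; rewrite outP_inP ?base_neq0 // /betaX mulrBl mul1r coefB.
  by rewrite coefXM subr0.
by rewrite coef_inP // !bin0; case: (nodeP nis) => /=; ring.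
Qed.

Lemma coef0_excess i : (excess i)`_0 = 0.
Proof. by rewrite coefB coef0_inP coef0_outP subrr. Qed.

Lemma coef0_backP i : (backP i)`_0 = 0.
Proof. by rewrite coef_sum big1 // => j _; rewrite coef0_excess. Qed.

Lemma coef0_forwP i : (forwP i)`_0 = 1.
Proof. by rewrite coefB coef0_outP coef0_backP subr0. Qed.

(** On out-copies let R and U have height 1 and L height 0, on in-copies let U have
    height 1 and R and L height 0.  The first order coefficient of an excess is
    - (m - 1) times the drop in height from i to pi i, plus 1 unless i or pi i is
    node 1. *)
Lemma coef1_excess i : i != s -> pi i != s -> (excess i)`_1 =
  (i \notin [set ord0; (pi^-1)%g ord0])%:R -
  (m%:R - 1) * ((i \notin L)%:R - (pi i \in U)%:R).
Proof.
move=> nis npis; rewrite coefB coef_inP // coef_outP // !bin1 natr_m1.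
have -> : (i \in [set ord0; (pi^-1)%g ord0]) = (i == ord0) || (pi i == ord0).
  by rewrite !inE -(inj_eq (@perm_inj _ pi) i ((pi^-1)%g ord0)) permKV.
have := pi_neq_both0 i.
by case: (nodeP nis); case: (nodeP npis) => //= _; ring.
Qed.

Lemma coef2_excess i : i != s -> pi i != s -> (excess i)`_2 =
  'C(m, 2)%:R * ((i \notin L)%:R - (pi i \in U)%:R) -
  (m%:R - 1) * (pi i \in L)%:R.
Proof.
move=> nis npis; rewrite coefB coef_inP // coef_outP // (@bin_small 1 2) //.
rewrite !natr_bin2 natr_m1.
have := pi_neq_both0 i.
by case: (nodeP nis); case: (nodeP npis) => //= _; field.
Qed.

(** * First and second order coefficients along the path *)

Definition inner (i : 'I_m.+1) := i \notin [set s; ord_pred s].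

Lemma innerP i : inner i = (0 < pos s i < m)%N.
Proof.
rewrite /inner !inE -(inj_eq (@pos_inj _ s)) -(inj_eq (@pos_inj _ s) i (ord_pred s)).
by rewrite pos_base pos_ord_pred_base; have := pos_le s i; lia.
Qed.

Lemma inner_Iset i j : inner i -> j \in Iset s i -> inner j.
Proof.
move=> ii; have ni : i != s by rewrite -pos_eq0; move: ii; rewrite innerP; lia.
by rewrite in_Iset // => ji; move: ii; rewrite !innerP; lia.
Qed.

Lemma inner_neq i : inner i -> i != s /\ pi i != s.
Proof.
rewrite /inner !inE negb_or => /andP[-> H]; split=> //.
by rewrite -pi_pred_base (inj_eq perm_inj).
Qed.

(** The accumulated drop in height; by [levelE] it is N_UL + N_UR + N_RL - N_LU. *)
Definition level (i : 'I_m.+1) : F :=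
  \sum_(j in Iset s i) ((j \notin L)%:R - (pi j \in U)%:R).

Lemma levelE i : inner i -> level i = (Nup s pi L U i)%:R - (N s pi L U i)%:R.
Proof.
move=> ii; rewrite /Nup /N !natrD -!sum_mem_card -!big_split -sumrB /=.
apply: eq_bigr => j /(inner_Iset ii)/inner_neq[njs npjs].
rewrite !inE njs.
have := pi_neq_both0 j.
by case: (nodeP njs); case: (nodeP npjs) => //= _; ring.
Qed.

Definition width (i : 'I_m.+1) : nat :=
  #|Iset s i :\: [set ord0; (pi^-1)%g ord0]|.

Lemma width_le i : inner i -> (width i <= m.-1)%N.
Proof.
move=> ii.
have : (width i <= #|~: [set s; ord_pred s]|)%N.
  apply/subset_leq_card/subsetP => j; rewrite !inE => /andP[_] ji.
  by have := inner_Iset ii ji; rewrite /inner !inE.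
have := cardsC [set s; ord_pred s]; rewrite cards2 eq_sym ord_pred_neq card_ord.
lia.
Qed.

Lemma coef1_backP i : inner i -> (backP i)`_1 =
  (excess s)`_1 + (width i)%:R - (m%:R - 1) * level i.
Proof.
move=> ii; have [nis _] := inner_neq ii.
rewrite backP_Iset // coefD coef_sum -addrA; congr (_ + _).
rewrite /width setDE -sum_mem_card /level mulr_sumr -sumrB.
apply: eq_bigr => j /(inner_Iset ii)/inner_neq[njs npjs].
by rewrite coef1_excess // in_setC.
Qed.

(** The second order terms that do not come from the level count the j in I(i)
    with pi j in L, and by injectivity of pi there are at most |L| of them. *)
Lemma coef2_backP_ge i : inner i ->
  (excess s)`_2 + 'C(m, 2)%:R * level i - (m%:R - 1) * #|L|%:R <= (backP i)`_2.
Proof.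
move=> ii; have [nis _] := inner_neq ii.
rewrite backP_Iset // coefD coef_sum -addrA lerD2l.
rewrite (eq_bigr (fun j => 'C(m, 2)%:R * ((j \notin L)%:R - (pi j \in U)%:R) -
  (m%:R - 1) * (j \in pi @^-1: L)%:R)); last first.
  move=> j /(inner_Iset ii)/inner_neq[njs npjs].
  by rewrite coef2_excess // inE.
rewrite sumrB -!mulr_sumr sum_mem_card lerD2l lerN2 ler_wpM2l //.
  by rewrite -natr_m1.
rewrite ler_nat; apply: leq_trans (subset_leq_card (subsetIr _ _)) _.
by rewrite card_preimset //; exact: perm_inj.
Qed.

(** s - 2, where I(i) is largest. *)
Definition lastinner : 'I_m.+1 := ord_pred (ord_pred s).

Lemma pos_lastinner : (pos s lastinner).+1 = m.
Proof.
by rewrite -pos_ord_pred ?ord_pred_neq // pos_ord_pred_base.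
Qed.

Lemma in_Iset_lastinner j : (1 < m)%N -> (j \in Iset s lastinner) = inner j.
Proof.
move=> m1; have pl := pos_lastinner.
by rewrite in_Iset -?(pos_eq0 s) ?innerP; lia.
Qed.

(** Every node occurs once as j and once as pi j, so the sum of the drops in height
    over the whole cycle is n - |L| - |U| = 2; the term of s vanishes, and that of
    s - 1 is [s - 1 not in L]. *)
Lemma level_lastinner : (1 < m)%N -> pi s \in U ->
  level lastinner = 2 - (ord_pred s \notin L)%:R.
Proof.
move=> m1 psU.
have e1 : \sum_i ((i \notin L)%:R - (pi i \in U)%:R) = 2 :> F.
  rewrite sumrB -(reindex_inj (P := predT) (F := fun i => (i \in U)%:R) (@perm_inj _ pi)) /=.
  rewrite (eq_bigr (fun i => 1 - (i \in L)%:R)); last by move=> i _; case: (i \in L) => /=; ring.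
  rewrite sumrB sumr_const card_ord -!(big_mkcond predT) /=.
  have sumT (A : {set 'I_m.+1}) : \sum_i (i \in A)%:R = #|A|%:R :> F.
    by rewrite -[A in RHS]setTI -sum_mem_card; apply: eq_bigl => i; rewrite inE.
  by rewrite !sumT natr_cardU -natr1; ring.
rewrite (bigD1 s) //= (bigD1 (ord_pred s)) ?ord_pred_neq //= in e1.
rewrite psU notin_Ls pi_pred_base (negPf notin_Us) /= in e1.
rewrite /level (eq_bigl (fun i => (i != s) && (i != ord_pred s))); last first.
  by move=> j; rewrite in_Iset_lastinner // /inner !inE negb_or.
by move: e1; set S := \sum_(_ | _) _; lra.
Qed.

(** * The sign conditions for an even number of nodes *)

Section Even.
Variable k : nat.
Hypotheses (hk : (m.+1 = 2 * k)%N) (hn6 : (6 <= m.+1)%N).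

Lemma natr_m : m%:R = 2 * k%:R - 1 :> F.
Proof. by apply: (addIr 1); rewrite natr1 hk natrM; ring. Qed.

Lemma k_ge3 : 3 <= k%:R :> F.
Proof. by rewrite ler_nat; lia. Qed.

Lemma natr_k1 : k.-1%:R = k%:R - 1 :> F.
Proof. by rewrite -[in RHS](@prednK k) -?natr1 ?addrK //; lia. Qed.

(** To first order the slacks of y_s are m - 1 times |L| + 1 - m/2 and m/2 - |L|,
    and m is odd. *)
Lemma cardL_of_base_bounds :
  near1 (fun beta : F => 0 <= (outP s - B ^+ m).[1 - beta]) ->
  near1 (fun beta : F => 0 <= (B - outP s).[1 - beta]) -> #|L| = k.-1.
Proof.
have B1 := coef_betaX_exp F 1; rewrite expr1 in B1.
move=> /near1_coef1_ge0 lo /near1_coef1_ge0 hi.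
move: lo hi; rewrite !(B1, coef_betaX_exp, coefB) !outP_base0 !bin0 outP_base1.
rewrite !bin1 !mulr1 !subrr => /(_ erefl) lo /(_ erefl) hi.
have k3 := k_ge3.
have e1 : 0 <= (m%:R - 1) * (2 * #|L|%:R + 2 - m%:R) :> F by lra.
have e2 : 0 <= (m%:R - 1) * (m%:R - 2 * #|L|%:R) :> F by lra.
have m1 : 0 < m%:R - 1 :> F by rewrite natr_m; lra.
move: e1 e2; rewrite !pmulr_rge0 // !subr_ge0 -natrM -natrD !ler_nat.
by move: hk; lia.
Qed.

Hypothesis hL : #|L| = k.-1.

Lemma coef1_outP_base : (outP s)`_1 = - k%:R.
Proof. by rewrite outP_base1 hL natr_k1 natr_m; field. Qed.

Lemma base_bounds :
  near1 (fun beta : F => 0 <= (outP s - B ^+ m).[1 - beta]) /\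
  near1 (fun beta : F => 0 <= (B - outP s).[1 - beta]).
Proof.
have B1 := coef_betaX_exp F 1; rewrite expr1 in B1; have k3 := k_ge3.
split; apply: (@near1_horner_ge0 _ _ 1) => [[|//] _|];
  rewrite !(B1, coef_betaX_exp, coefB) ?outP_base0 ?coef1_outP_base ?bin0 ?bin1;
  rewrite ?natr_m; lra.
Qed.

Lemma coef1_excess_base : (excess s)`_1 =
  if pi s \in U then k%:R else if pi s \in L then 2 - k%:R else 1 - k%:R.
Proof.
rewrite coefB coef1_outP_base coef_inP ?pi_neq // !bin1 natr_m1 natr_m.
by case: (nodeP (pi_neq s)) => /=; ring.
Qed.

Lemma pi_base_in_U : 0 <= (excess s)`_1 -> pi s \in U.
Proof.
rewrite coef1_excess_base; case: ifP => // _; have := k_ge3.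
by case: ifP => _; lra.
Qed.

Hypothesis psU : pi s \in U.

Lemma coef1_backP_even i : inner i -> (backP i)`_1 =
  k%:R + (width i)%:R - (2 * k%:R - 2) * level i.
Proof.
by move=> ii; rewrite coef1_backP // coef1_excess_base psU natr_m; ring.
Qed.

Lemma coef2_excess_base :
  (excess s)`_2 = (2 * k%:R - 2) * (2 * k%:R - 1) * (k%:R - 3) / 6.
Proof.
rewrite coefB outP_base2 coef_inP ?pi_neq // hL natr_k1 natr_m.
by have := psU; case: (nodeP (pi_neq s)) => //= _; field.
Qed.

(** This settles the case where the first order coefficient vanishes. *)
Lemma coef2_backP_gt0 i : inner i -> level i = 1 -> 0 < (backP i)`_2.
Proof.
move=> ii l1; apply: lt_le_trans (coef2_backP_ge ii).
rewrite l1 natr_bin2 hL natr_k1 coef2_excess_base natr_m.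
rewrite [X in 0 < X](_ : _ = (k%:R - 1) * (2 * k%:R - 3) * (k%:R - 2) / 3).
  by have k3 := k_ge3; rewrite divr_gt0 // !mulr_gt0 //; lra.
by field.
Qed.

(** At level 2 or more, even the largest possible width m - 1 = 2k - 2 leaves the
    first order coefficient at most 2 - k < 0. *)
Lemma level_le1 i : inner i -> 0 <= (backP i)`_1 ->
  (Nup s pi L U i <= (N s pi L U i).+1)%N.
Proof.
move=> ii; rewrite coef1_backP_even // levelE // => c1.
rewrite leqNgt; apply/negP => lt2.
have : (N s pi L U i)%:R + 2 <= (Nup s pi L U i)%:R :> F.
  by rewrite -natrD ler_nat; lia.
have : (width i)%:R <= 2 * k%:R - 2 :> F.
  have -> : 2 * k%:R - 2 = m.-1%:R :> F by rewrite natr_m1 natr_m; ring.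
  by rewrite ler_nat width_le.
have k3 := k_ge3; move: c1; set x := (Nup _ _ _ _ _)%:R; set y := (N _ _ _ _ _)%:R.
set w := (width i)%:R; set K := k%:R in k3 *.
nra.
Qed.

Lemma width_ge i : inner i -> Nup s pi L U i = (N s pi L U i).+1 ->
  0 <= (backP i)`_1 -> (k - 2 <= width i)%N.
Proof.
move=> ii l1; rewrite coef1_backP_even // levelE // l1 -natr1 => c1.
have : k%:R <= (width i)%:R + 2 :> F by lra.
by rewrite -natrD ler_nat; lia.
Qed.

Lemma backP_ge0_level0 i : inner i -> (Nup s pi L U i <= N s pi L U i)%N ->
  near1 (fun beta : F => 0 <= (backP i).[1 - beta]).
Proof.
move=> ii l0; apply: (@near1_horner_ge0 _ _ 1).
  by case=> // _; exact: coef0_backP.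
rewrite coef1_backP_even // levelE //.
have : (Nup s pi L U i)%:R <= (N s pi L U i)%:R :> F by rewrite ler_nat.
have k3 := k_ge3; have : 0 <= (width i)%:R :> F by [].
set x := (Nup _ _ _ _ _)%:R; set y := (N _ _ _ _ _)%:R; nra.
Qed.

Lemma backP_ge0_level1 i : inner i -> Nup s pi L U i = (N s pi L U i).+1 ->
  (k - 2 <= width i)%N ->
  near1 (fun beta : F => 0 <= (backP i).[1 - beta]).
Proof.
move=> ii e1 wi; have l1 : level i = 1 by rewrite levelE // e1 -natr1; ring.
have c1 : (backP i)`_1 = (width i - (k - 2))%:R.
  rewrite coef1_backP_even // l1 natrB // natrB; last lia.
  by ring.
have [w0|] := posnP (width i - (k - 2)); last first.
  move=> wp; apply: (@near1_horner_ge0 _ _ 1); last by rewrite c1 ltr0n.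
  by case=> // _; exact: coef0_backP.
apply: (@near1_horner_ge0 _ _ 2); last exact: coef2_backP_gt0.
by case=> [|[|]] // _; [exact: coef0_backP | rewrite c1 w0].
Qed.

End Even.
End Basis.

Theorem theorem4p3 (F : realType) (m k : nat) (hn : m.+1 = 2 * k) (hn6 : 6 <= m.+1)
    (s : 'I_m.+1) (pi : {perm 'I_m.+1}) (L U : {set 'I_m.+1})
    (hadm : admissible s pi L U) :
  feasible_basis F s pi L U <->
  [/\ #|U| = k.-1 /\ #|L| = k.-1,
      pi s \in U,
      ord_pred s \in Rset m :|: U
    & exists istar : 'I_m.+1,
        [/\ is_istar s pi L U istar,
            (m.+1 - 4)./2 <= #|Iset s istar :\: [set ord0; (pi^-1)%g ord0]|
          & forall i : 'I_m.+1,
              i \notin [set s; ord_pred s] -> i \notin Iset s istar ->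
              Nup s pi L U i <= (N s pi L U i).+1]].
Proof.
have halfE : (m.+1 - 4)./2 = k - 2 by rewrite hn; lia.
have cardU_of : #|L| = k.-1 -> #|U| = k.-1.
  by have := card_class hadm; lia.
split=> [/(feasible_basisE F hadm) feas|].
  have lo := near1_imp (fun b _ (H : [/\ _, _, _ & _]) => let: And4 h _ _ _ := H in h) feas.
  have hi := near1_imp (fun b _ (H : [/\ _, _, _ & _]) => let: And4 _ h _ _ := H in h) feas.
  have bk i := near1_imp (fun b _ (H : [/\ _, _, _ & _]) => let: And4 _ _ _ h := H in h i) feas.
  have cardL := cardL_of_base_bounds hadm hn hn6 lo hi.
  have c1 i : (0 <= (backP F s pi L U i)`_1)%R.
    apply: near1_coef1_ge0 (coef0_backP F hadm i) _; exact: bk.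
  have psU : pi s \in U.
    by apply: (pi_base_in_U hadm hn hn6 cardL); rewrite -backP_base.
  have le1 i (ii : inner s i) := level_le1 hadm hn hn6 cardL psU ii (c1 i).
  have m1 : 1 < m by lia.
  have inl : inner s (lastinner s).
    by have := pos_lastinner hadm; rewrite innerP; lia.
  have levl := level_lastinner F hadm m1 psU.
  have nsL : ord_pred s \notin L.
    apply/negP => sL; move: levl (le1 _ inl); rewrite sL levelE // => levl.
    rewrite -(ler_nat F) -natr1 => H.
    by move: levl H => /=; lra.
  have upl : Nup s pi L U (lastinner s) = (N s pi L U (lastinner s)).+1.
    apply/eqP; rewrite -(eqr_nat F) -natr1.
    by move: levl; rewrite nsL levelE // => levl; apply/eqP; move: levl => /=; lra.
  split=> //; first by split=> //; exact: cardU_of.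
    by move: nsL; rewrite (in_L hadm) !inE (ord_pred_neq hadm) //; case: eqP => //=; rewrite negbK.
  (* once all levels are at most 1, the first inner node of level 1 is i* *)
  pose P i := inner s i && (Nup s pi L U i == (N s pi L U i).+1).
  have Pl : P (lastinner s) by rewrite /P inl upl eqxx.
  case: (arg_minnP (pos s) Pl) => i /andP[ii /eqP upi] imin.
  have [nis _] := inner_neq hadm ii.
  exists i; split; last by move=> j ij _; exact: le1.
    split=> // j; rewrite in_setD1 => /andP[nji ji].
    have ij := inner_Iset ii ji.
    have := le1 j ij; rewrite leq_eqVlt => /orP[e|]; last by rewrite ltnS.
    have := imin j; rewrite /P ij e => /(_ isT).
    by move: ji; rewrite in_Iset // -(inj_eq (@pos_inj _ s)) in nji *; lia.
  rewrite halfE; exact: (width_ge hadm hn hn6 cardL psU ii upi (c1 i)).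
move=> [[cardU cardL] psU _ [t [[it upt tmin] wt le1]]].
rewrite halfE in wt; apply/(feasible_basisE F hadm).
have [nts _] := inner_neq hadm it.
have back i : near1 (fun beta : F => 0 <= (backP F s pi L U i).[1 - beta])%R.
  have [->|nil] := eqVneq i (ord_pred s).
    by apply: near1T => b _; rewrite backP_pred_base // horner0.
  have [->|nis] := eqVneq i s.
    rewrite backP_base; apply: (@near1_horner_ge0 _ _ 1).
      by case=> // _; exact: coef0_excess.
    by rewrite (coef1_excess_base F hadm hn hn6 cardL) psU ltr0n; lia.
  have ii : inner s i by rewrite /inner !inE negb_or nis.
  have step : Nup s pi L U i <= (N s pi L U i).+1 -> (k - 2 <= width s pi i) ->
      near1 (fun beta : F => 0 <= (backP F s pi L U i).[1 - beta])%R.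
    rewrite leq_eqVlt => /orP[/eqP e|e] wi.
      exact: (backP_ge0_level1 F hadm hn hn6 cardL psU ii e wi).
    by apply: (backP_ge0_level0 F hadm hn hn6 cardL psU ii); rewrite -ltnS.
  have [iI|niI] := boolP (i \in Iset s t).
    have [->|nit] := eqVneq i t.
      exact: (backP_ge0_level1 F hadm hn hn6 cardL psU it upt wt).
    apply: (backP_ge0_level0 F hadm hn hn6 cardL psU ii).
    by apply: tmin; rewrite in_setD1 nit.
  apply: step; first exact: le1.
  apply: leq_trans wt _; apply/subset_leq_card/setSD/subsetP => j.
  by move: niI; rewrite !in_Iset //; move: ii it; rewrite !innerP; lia.
have forw i : near1 (fun beta : F => 0 <= (forwP F s pi L U i).[1 - beta])%R.
  by apply: (@near1_horner_ge0 _ _ 0) => //; rewrite coef0_forwP.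
have [lo hi] := base_bounds F hadm hn hn6 cardL.
have := near1_and (near1_and lo hi) (near1_and (near1_forall forw) (near1_forall back)).
by apply: near1_imp => b _ [[? ?] [? ?]].
Qed.
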